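(* Let $\theta:W\to W$ be defined recursively by $\theta(\varepsilon)=\varepsilon$ for the empty word $\varepsilon$ and, for nonempty $w\in W$, $$\theta(w)=\theta(w\setminus\mathsf{srw}(w))*\delta_d(\mathsf{srw}(w)),\qquad d=\mathsf{srdes}(w),$$ where $*$ is concatenation and, if $c_1<c_2<\cdots<c_m$ are the entries of $\mathsf{srw}(w)$, $\delta_d(\mathsf{srw}(w))=c_{d+1}c_1c_2\cdots c_dc_{d+2}\cdots c_m$. Then $\theta$ is a well-defined bijection of $W$ such that $\mathsf{des}(w)=\mathsf{lec}(\theta(w))$ for all $w\in W$. Moreover, the restriction of $\theta$ to the symmetric group $\mathcal S_n$ (permutations written in one-line notation) is a bijection $\mathcal S_n\to\mathcal S_n$.
   Context: $W$ is the set of all finite words ($\ell\ge0$) of positive integers with pairwise distinct entries. For $u=u_1\cdots u_\ell$, $\mathsf{des}(u)=\#\{j\in[\ell-1]:u_j>u_{j+1}\}$ and $\mathsf{inv}(u)=\#\{(p,q):p<q,\ u_p>u_q\}$. Special reverse wave: let $w=w_1\cdots w_\ell\in W$ be nonempty. If the entries of $w$ are increasing, $\mathsf{srw}(w)=w$ (and $s:=\ell$). Otherwise let $t$ be the minimal index with $w_t>w_{t+1}$, set $w_0=0$, and let $s$ be the maximal index with $t\le s\le \ell$ such that $w_t>w_{t+1}>\cdots>w_s>w_{t-1}$; then $\mathsf{srw}(w)=w_1\cdots w_s$. $w\setminus\mathsf{srw}(w)$ is the suffix $w_{s+1}\cdots w_\ell$. $\mathsf{srdes}(w)=\mathsf{des}(\mathsf{srw}(w))+\chi$,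 where $\chi=1$ if $s<\ell$ and $w_s>w_{s+1}$, else $\chi=0$. Hook factorization: every $w\in W$ decomposes uniquely as $w=\gamma*\alpha_1*\cdots*\alpha_m$ with $\gamma$ a possibly empty increasing word and each $\alpha_j=a_1\cdots a_r$ a hook ($r\ge2$, $a_1>a_2$, $a_2<\cdots<a_r$); $\mathsf{lec}(w)=\sum_j\mathsf{inv}(\alpha_j)$. *)

(* Defs.v *)
From HB Require Import structures.
From mathcomp Require Import all_boot all_fingroup.

Set Implicit Arguments.
Unset Strict Implicit.
Unset Printing Implicit Defensive.

Record W := Word { wval :> seq nat; _ : uniq wval && all (ltn 0) wval }.

HB.instance Definition _ := [isSub for wval].
HB.instance Definition _ := [Countable of W by <:].

Lemma W_emptyP : uniq ([::] : seq nat) && all (ltn 0) [::]. Proof. by []. Qed.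

Definition W_empty : W := Word W_emptyP.

Lemma W_dropP (k : nat) (w : W) : uniq (drop k w) && all (ltn 0) (drop k w).
Proof.
case: w => w /= /andP[Uw /allP Pw]; rewrite drop_uniq //=.
by apply/allP => x /mem_drop; apply: Pw.
Qed.

Definition W_drop (k : nat) (w : W) : W := Word (W_dropP k w).

(* Letters are numbered from 1; [letter u 0 = 0] is the convention w_0 = 0. *)
Definition letter (u : seq nat) (i : nat) : nat := nth 0 (0 :: u) i.

(* Increasing list of the j in [1, size u - 1] with u_j > u_{j+1}. *)
Definition descents (u : seq nat) : seq nat :=
  [seq j <- iota 1 (size u).-1 | letter u j.+1 < letter u j].

Definition des (u : seq nat) : nat := size (descents u).

Definition word_inv (u : seq nat) : nat :=
  size [seq pq <- [seq (p, q) | p <- iota 1 (size u), q <- iota 1 (size u)]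
       | (pq.1 < pq.2) && (letter u pq.2 < letter u pq.1)].

Definition first_descent (w : seq nat) : nat := head 0 (descents w).

Definition srw_index (w : seq nat) (t s : nat) : bool :=
  all (fun j => letter w j.+1 < letter w j) (iota t (s - t))
    && (letter w t.-1 < letter w s).

(* The index s of the special reverse wave, i.e. its length; in the second
   branch it is the last element of the increasing list of admissible s. *)
Definition srw_size (w : seq nat) : nat :=
  if sorted ltn w then size w
  else let t := first_descent w in
       last 0 [seq s <- iota t (size w - t).+1 | srw_index w t s].

Definition srw (w : seq nat) : seq nat := take (srw_size w) w.

Definition srw_rest (w : W) : W := W_drop (srw_size w) w.

Definition srdes (w : seq nat) : nat :=
  let s := srw_size w in
  des (srw w) + ((s < size w) && (letter w s.+1 < letter w s)).

(* Meaningful for [d < size u]. *)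
Definition delta (d : nat) (u : seq nat) : seq nat :=
  let c := sort leq u in letter c d.+1 :: take d c ++ drop d.+1 c.

Definition theta_rec (theta : W -> W) : Prop :=
  theta W_empty = W_empty /\
  forall w : W, w <> W_empty ->
    wval (theta w) = theta (srw_rest w) ++ delta (srdes w) (srw w).

Definition hook (a : seq nat) : bool :=
  [&& 2 <= size a, letter a 2 < letter a 1 & sorted ltn (behead a)].

(* [f] is the pair of the increasing word gamma and the list of hooks. *)
Definition hook_factorization (w : seq nat) (f : seq nat * seq (seq nat)) :
    bool :=
  [&& w == f.1 ++ flatten f.2, sorted ltn f.1 & all hook f.2].

Lemma hook_factorization_exists (w : W) : exists f, hook_factorization w f.
Proof.
case: w => w /= /andP[+ _]; elim: w => [|x w IHw] /=.
  by exists ([::], [::]).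
move=> /andP[xNw /IHw[[g al] /and3P[/= /eqP defw sg hal]]].
case: g => [|y g] in defw sg *.
  by exists ([:: x], al); rewrite /hook_factorization /= defw eqxx.
case: (ltngtP x y) => [ltxy | ltyx | eqxy].
- exists (x :: y :: g, al).
  by move: sg; rewrite /hook_factorization /= defw eqxx hal ltxy => /= ->.
- exists ([::], (x :: y :: g) :: al).
  by move: sg; rewrite /hook_factorization /hook /letter /= defw eqxx hal ltyx => ->.
by move: xNw; rewrite defw eqxy mem_head.
Qed.

Lemma hook_factorization_unique (w : seq nat) f1 f2 :
  hook_factorization w f1 -> hook_factorization w f2 -> f1 = f2.
Proof.
have nilP g al : hook_factorization [::] (g, al) -> (g, al) = ([::], [::]).
  case/and3P=> /= /eqP/esym; case: g => //= + _.
  by case: al => // [[|x a] al].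
have consP x u g al : hook_factorization (x :: u) (g, al) ->
    (exists g', [/\ g = x :: g', path ltn x g' & hook_factorization u (g', al)])
    \/ (exists y b al', [/\ (g, al) = ([::], (x :: y :: b) :: al'), y < x
          & hook_factorization u (y :: b, al')]).
  case/and3P=> /=; case: g => [|z g] /= /eqP.
    case: al => [|[|z [|y b]] al] //= [<- ->] _ /andP[/and3P[_ lt_yx sb] hal].
    right; exists y, b, al; split=> //.
    by rewrite /hook_factorization /= eqxx hal; move: sb => /= ->.
  case=> <- -> pg hal; left; exists g; split=> //.
  by rewrite /hook_factorization /= eqxx hal (path_sorted pg).
elim: w f1 f2 => [|x w IHw] [g1 a1] [g2 a2]; first by move=> /nilP-> /nilP->.
move=> /consP[[g1' [-> p1 h1]] | [y1 [b1 [a1' [-> lt1 h1]]]]];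
move=> /consP[[g2' [-> p2 h2]] | [y2 [b2 [a2' [-> lt2 h2]]]]];
case: (IHw _ _ h1 h2).
- by move=> -> ->.
- by move=> eg _; move: p1; rewrite eg /= ltnNge ltnW.
- by move=> eg _; move: p2; rewrite -eg /= ltnNge ltnW.
- by move=> -> -> ->.
Qed.

Definition lec (w : W) : nat :=
  \sum_(a <- (xchoose (hook_factorization_exists w)).2) word_inv a.

Lemma onelineP (n : nat) (sigma : 'S_n) :
  let u := [seq (sigma i).+1 | i <- enum 'I_n] in uniq u && all (ltn 0) u.
Proof.
apply/andP; split; last by apply/allP => _ /mapP[i _ ->].
by rewrite map_inj_uniq ?enum_uniq // => i j [/val_inj/perm_inj].
Qed.

Definition oneline (n : nat) (sigma : 'S_n) : W := Word (onelineP sigma).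

(* Main.v *)
Require Import Defs.
From HB Require Import structures.
From mathcomp Require Import all_boot all_fingroup.
From mathcomp Require Import zify.

(* A special reverse wave w_1 ... w_s is p ++ q with p increasing, q nonempty
   and decreasing, and every letter of p below every letter of q; it is
   determined by its content c_1 < ... < c_m and the length of q. The word
   delta_d of that content is increasing for d = 0, which only happens when the
   whole word is increasing, and is a hook with d inversions for d > 0. Hence
   the recursion for theta appends exactly one hook to the hook factorization,
   and des is carried to lec.

   Conversely, theta w determines its last hook, and with it c and d, and by
   induction the rest v of w. The wave then has either d or d - 1 descents, the
   latter iff v is nonempty with v_1 < c_{m-d}. So theta is injective; as it
   only rearranges letters, it permutes the finite set of rearrangements of
   each word. *)

Set Implicit Arguments.
Unset Strict Implicit.
Unset Printing Implicit Defensive.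

(** * Letters, descents and inversions of words *)

Lemma W_uniq (w : W) : uniq w.
Proof. by case: w => w /= /andP[]. Qed.

Lemma W_gt0 (w : W) : all (ltn 0) w.
Proof. by case: w => w /= /andP[]. Qed.

Lemma W_neq_empty (w : W) : w <> W_empty <-> wval w <> [::].
Proof.
by split=> w0 w1; apply: w0; [apply: val_inj|rewrite w1].
Qed.

Lemma letter_catl (u v : seq nat) i : i <= size u -> letter (u ++ v) i = letter u i.
Proof. by move=> le_iu; rewrite /letter -cat_cons nth_cat /= ltnS le_iu. Qed.

(** The position is [i.+1] because [letter v 0] is the convention [0], not the last letter of
    [u]. *)
Lemma letter_catr (u v : seq nat) i :
  letter (u ++ v) (size u + i.+1) = letter v i.+1.
Proof.
by rewrite /letter -cat_cons nth_cat /= ltnNge addnS ltnS leq_addr /= subSS addKn.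
Qed.

Lemma letter_size (u : seq nat) : letter u (size u) = last 0 u.
Proof. by rewrite /letter -[size u]/((size (0 :: u)).-1) nth_last. Qed.

Lemma des_cons2 x y u : des [:: x, y & u] = (y < x) + des (y :: u).
Proof.
rewrite /des /descents !size_filter /= -[2]/(1 + 1) iotaDl count_map.
by congr (_ + _); apply: eq_in_count => -[|j] //; rewrite mem_iota.
Qed.

(** Without the test [v != [::]], the default [0] of [head 0 v] could count as a descent. *)
Lemma des_cat x u v :
  des (x :: u ++ v) = des (x :: u) + des v + ((v != [::]) && (head 0 v < last x u)).
Proof.
elim: u x => [|y u IHu] x /=; last by rewrite !des_cons2 IHu !addnA.
by case: v => [|z v] //; rewrite des_cons2 addnC.
Qed.

Lemma des_increasing u : sorted ltn u -> des u = 0.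
Proof.
case: u => // x u; elim: u x => //= y u IHu x /andP[lt_xy /IHu].
by rewrite des_cons2 ltnNge (ltnW lt_xy) => ->.
Qed.

Lemma des_decreasing u : sorted gtn u -> des u = (size u).-1.
Proof.
case: u => // x u; elim: u x => //= y u IHu x /andP[lt_xy /IHu].
by rewrite des_cons2 lt_xy => ->.
Qed.

Lemma word_inv_count u : word_inv u =
  \sum_(p <- iota 1 (size u))
    count (fun q => (p < q) && (letter u q < letter u p)) (iota 1 (size u)).
Proof.
rewrite /word_inv size_filter.
elim: {2 3}(iota 1 (size u)) => [|p s IHs] /=; first by rewrite big_nil.
by rewrite big_cons count_cat IHs count_map.
Qed.

Lemma word_inv_cons x u : word_inv (x :: u) = count (fun y => y < x) u + word_inv u.
Proof.
rewrite !word_inv_count /= big_cons /=; congr (_ + _).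
  rewrite -[2]/(2 + 0) iotaDl count_map add0n.
  by rewrite -[in RHS](mkseq_nth 0 u) /mkseq count_map; apply: eq_count.
(* Here [p] exceeds 1, so [q = 1] contributes nothing, and shifting both positions by one gives the
   inversions of [u]. *)
rewrite -[2]/(1 + 1) iotaDl big_map; apply: eq_big_seq => p.
rewrite mem_iota => /andP[p1 _].
rewrite count_map /= add0n; apply: eq_in_count => q; rewrite mem_iota => /andP[q1 _] /=.
by rewrite ltnS; case: p q p1 q1 => [|p] [|q].
Qed.

Lemma word_inv_increasing u : sorted ltn u -> word_inv u = 0.
Proof.
elim: u => // x u IHu; rewrite /= (path_sortedE ltn_trans) => /andP[ltxu /IHu su].
rewrite word_inv_cons su addn0; apply/eqP; rewrite -leqn0 leqNgt -has_count.
apply/hasPn => y /(allP ltxu) /= lt_xy; lia.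
Qed.

(** * The words [delta d u] *)

Lemma delta_cons d u :
  delta d u = nth 0 (sort leq u) d :: take d (sort leq u) ++ drop d.+1 (sort leq u).
Proof. by []. Qed.

Lemma perm_delta d u : d < size u -> perm_eq (delta d u) u.
Proof.
move=> ltdu; rewrite delta_cons // perm_sym -(perm_sort leq u).
rewrite -{1}(cat_take_drop d (sort leq u)) (drop_nth 0) ?size_sort //.
by rewrite perm_catC /= perm_cons perm_catC.
Qed.

Lemma sort_increasing u c : perm_eq u c -> sorted ltn c -> sort leq u = c.
Proof.
move=> uc; rewrite ltn_sorted_uniq_leq => /andP[_ sc].
apply: (sorted_eq leq_trans anti_leq) => //; first exact: (sort_sorted leq_total).
by rewrite perm_sort.
Qed.

Lemma take_drop_increasing d (c : seq nat) :
  sorted ltn c -> sorted ltn (take d c ++ drop d.+1 c).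
Proof.
move=> sc; apply: (subseq_sorted ltn_trans _ sc).
rewrite -{3}(cat_take_drop d c); apply: cat_subseq => //.
by rewrite -add1n -drop_drop; apply: drop_subseq.
Qed.

Lemma sort_uniq_increasing u : uniq u -> sorted ltn (sort leq u).
Proof.
by move=> Uu; rewrite ltn_sorted_uniq_leq sort_uniq Uu sort_sorted //; apply: leq_total.
Qed.

Lemma delta0_increasing u : uniq u -> 0 < size u -> sorted ltn (delta 0 u).
Proof.
move=> Uu u_gt0; rewrite delta_cons // take0 cat0s -drop_nth ?size_sort // drop0.
exact: sort_uniq_increasing.
Qed.

Lemma hook_delta d u : uniq u -> 0 < d < size u -> hook (delta d u).
Proof.
move=> Uu /andP[d_gt0 ltdu]; rewrite delta_cons //.
have sc := sort_uniq_increasing Uu.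
have := take_drop_increasing d sc; rewrite /hook /letter /= => ->; rewrite andbT.
have szc : size (sort leq u) = size u by rewrite size_sort.
apply/andP; split; first by rewrite size_cat size_take size_drop szc ltdu; lia.
rewrite nth_cat size_take szc ltdu d_gt0 nth_take //.
by rewrite (sorted_ltn_nth ltn_trans) // inE szc; lia.
Qed.

(** The first letter c_{d+1} exceeds exactly c_1, ..., c_d among the others, and the others are in
    increasing order. *)
Lemma word_inv_delta d u : uniq u -> d < size u -> word_inv (delta d u) = d.
Proof.
move=> Uu ltdu; rewrite delta_cons //.
have sc := sort_uniq_increasing Uu.
have szc : size (sort leq u) = size u by rewrite size_sort.
rewrite word_inv_cons word_inv_increasing ?take_drop_increasing // addn0 count_cat.
set x := nth _ _ _.
have /eqP-> : count (fun y => y < x) (drop d.+1 (sort leq u)) == 0.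
  rewrite -leqn0 leqNgt -has_count; apply/hasPn => y /(nthP 0)[i].
  rewrite size_drop szc nth_drop => ltid <-; rewrite -leqNgt ltnW //.
  by rewrite (sorted_ltn_nth ltn_trans) // ?inE ?szc; lia.
rewrite addn0 -[RHS](_ : size (take d (sort leq u)) = d); last first.
  by rewrite size_take szc ltdu.
apply/eqP; rewrite -all_count; apply/(all_nthP 0) => i.
rewrite size_take szc ltdu => ltid; rewrite nth_take //.
by rewrite (sorted_ltn_nth ltn_trans) // inE szc; lia.
Qed.

(** Rearranging preserves the content; since entries are distinct, the first letter c_{d+1} then
    reveals d. *)
Lemma delta_inj_index d1 d2 u1 u2 : uniq u1 -> d1 < size u1 -> d2 < size u2 ->
  delta d1 u1 = delta d2 u2 -> sort leq u1 = sort leq u2 /\ d1 = d2.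
Proof.
move=> U1 lt1 lt2 eq_d.
have eqs : sort leq u1 = sort leq u2.
  apply/(perm_sortP leq_total leq_trans anti_leq).
  by rewrite -(permPl (perm_delta lt1)) eq_d perm_delta.
split=> //; move: eq_d; rewrite !delta_cons // => -[+ _] => /eqP.
rewrite -eqs nth_uniq ?sort_uniq // ?size_sort // => [/eqP //|].
by rewrite -(size_sort leq u1) eqs size_sort.
Qed.

(** * Splitting off the special reverse wave *)

(* Data of a special reverse wave [p ++ q] of [p ++ q ++ v]: here [q] is the
   decreasing run w_t ... w_s and [last 0 p] is w_{t-1}, with w_0 = 0. *)
Definition wave_split (p q v : seq nat) : bool :=
  [&& q != [::], path ltn 0 (p ++ rev q)
    & [|| v == [::], (1 < size q) && (last 0 q < head 0 v)
        | (v != [::]) && (head 0 v < last 0 p)]].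

Lemma maximal_path_prefix (e : rel nat) x s :
  exists s1 s2, [/\ s = s1 ++ s2, path e x s1
                 & (s2 != [::]) ==> ~~ e (last x s1) (head 0 s2)].
Proof.
elim: s x => [|y s IHs] x; first by exists [::], [::].
have [exy|Nexy] := boolP (e x y); last by exists [::], (y :: s).
have [s1 [s2 [-> p12 es]]] := IHs y.
by exists (y :: s1), s2; rewrite /= exy.
Qed.

Lemma path_ltn_rev a q : path ltn a (rev q) = all (ltn a) q && sorted gtn q.
Proof. by rewrite (path_sortedE ltn_trans) all_rev rev_sorted. Qed.

(** Take for [p] the longest increasing prefix without its last letter x = w_t, and for [q] the
    letter x followed by the longest decreasing run staying above [last 0 p]. *)
Lemma wave_split_exists (w : W) : w <> W_empty ->
  exists p q v, wval w = p ++ q ++ v /\ wave_split p q v.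
Proof.
move=> /W_neq_empty; have := W_uniq w; have := W_gt0 w.
move: (wval w) => {}w w_gt0 Uw w0.
have [s1 [s2 [def_w]]] := maximal_path_prefix ltn 0 w.
(* The prefix is nonempty, since the first letter exceeds w_0 = 0. *)
case/lastP: s1 def_w => [|p x] def_w.
  by case: w w0 w_gt0 Uw def_w => //= y w _ /andP[y_gt0 _] _ <- /=; rewrite y_gt0.
rewrite last_rcons rcons_path => /andP[pp /= lt_px] max1.
have [q [v [def_s2]]] :=
  maximal_path_prefix (fun a b => (b < a) && (last 0 p < b)) x s2.
move=> pq max2; exists p, (x :: q), v.
split; first by rewrite def_w def_s2 cat_rcons.
rewrite /wave_split /= cat_path pp path_ltn_rev /= lt_px.
have -> : all (ltn (last 0 p)) q.
  elim: q x pq {def_w lt_px max1 def_s2 max2} => //= y q IHq x /andP[/andP[_ ->]].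
  exact: IHq.
rewrite (sub_path _ pq) /=; last by move=> a b /andP[].
case: v => //= y v in def_s2 max2 *.
have yw : y \in w by rewrite def_w def_s2 !mem_cat mem_head !orbT.
have y_gt0 := allP w_gt0 _ yw.
(* Distinctness, or positivity if [p] is empty, turns the failed maximality tests into strict
   inequalities. *)
have yNp : y != last 0 p.
  case/lastP: p def_w {pp lt_px max1 max2 pq} => [|p z] def_w; first by rewrite -lt0n.
  rewrite last_rcons; apply: contraTneq Uw => eyz; rewrite def_w def_s2 eyz.
  rewrite cat_uniq negb_and; apply/orP; right; rewrite negb_and; apply/orP; left.
  by rewrite negbK; apply/hasP; exists z;
    rewrite ?mem_rcons ?inE ?mem_cat ?mem_rcons ?mem_head ?orbT.
have yNq : y != last x q.
  apply: contraTneq Uw => eyz; rewrite def_w def_s2 cat_rcons cat_uniq.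
  rewrite -cat_cons cat_uniq negb_and; apply/orP; right.
  rewrite negb_and; apply/orP; right.
  rewrite negb_and; apply/orP; right; rewrite negb_and; apply/orP; left.
  by rewrite negbK; apply/hasP; exists y; rewrite ?mem_head // eyz mem_last.
(* A run longer than x stops at an ascent or below [last 0 p]. If the run is x alone, maximality of
   the prefix gives [y < x], so [y] is below [last 0 p]. *)
case: q => [|z q] in def_s2 max2 yNq pq def_w *; last by move: max2 yNq => /=; lia.
by move: max1 max2 yNq; rewrite def_s2 /=; lia.
Qed.

(** Serves to evaluate the maximum that defines [srw_size]. *)
Lemma last_filter_iota_leq (P : pred nat) t n b : t <= b < t + n ->
  (forall s, t <= s < t + n -> P s = (s <= b)) -> last 0 [seq s <- iota t n | P s] = b.
Proof.
move=> /andP[letb ltb] PE.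
rewrite (@eq_in_filter _ _ (fun s => s <= b)); last first.
  by move=> s; rewrite mem_iota; apply: PE.
have -> : n = (b - t) + (1 + (t + n - b).-1) by lia.
rewrite iotaD filter_cat subnKC // iotaD filter_cat /= leqnn last_cat /=.
rewrite (@eq_in_filter _ _ pred0) ?filter_pred0 // => s.
by rewrite mem_iota /= => /andP[]; lia.
Qed.

Section WaveSplit.

Variables (p q v : seq nat).
Hypothesis wave_pqv : wave_split p q v.

Let w := p ++ q ++ v.

Let q_gt0 : 0 < size q.
Proof. by case/and3P: wave_pqv; case: q. Qed.

Let increasing_pq : path ltn 0 (p ++ rev q).
Proof. by case/and3P: wave_pqv. Qed.

Let decreasing_q : all (ltn (last 0 p)) q && sorted gtn q.
Proof. by move: increasing_pq; rewrite cat_path path_ltn_rev => /andP[]. Qed.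

Let last_p_lt_last_q : last 0 p < last 0 q.
Proof.
case/andP: decreasing_q => /allP ltpq _; apply: ltpq.
by case: q q_gt0 => // x q' _; apply: mem_last.
Qed.

Let letter_p j : j <= size p -> letter w j < letter w j.+1.
Proof.
rewrite /w; case: q q_gt0 decreasing_q increasing_pq => // x q' _ dq.
rewrite cat_path => /andP[/(pathP 0) pp _]; rewrite leq_eqVlt => /predU1P[->|ltj].
  rewrite letter_catl // letter_size -(addn1 (size p)) letter_catr.
  by case/andP: dq => /andP[].
by rewrite (letter_catl _ ltj) (letter_catl _ (ltnW ltj)); exact: (pp j ltj).
Qed.

Let letter_q j : size p < j < size p + size q -> letter w j.+1 < letter w j.
Proof.
move=> /andP[ltpj ltjq]; have -> : j = size p + (j - (size p).+1).+1 by lia.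
rewrite /w -addnS !letter_catr !letter_catl; try lia.
case/andP: decreasing_q => _ /(sortedP 0) sq; apply: sq; lia.
Qed.

Let letter_last_p : letter w (size p) = last 0 p.
Proof. by rewrite letter_catl // letter_size. Qed.

Let letter_last_q : letter w (size p + size q) = last 0 q.
Proof.
by rewrite /w -(prednK q_gt0) letter_catr prednK // letter_catl // letter_size.
Qed.

Let letter_head_v : letter w (size p + size q).+1 = head 0 v.
Proof. by rewrite /w catA -size_cat -addn1 letter_catr; case: v. Qed.

Lemma wave_split_size : srw_size w = size p + size q.
Proof.
have szw : size w = size p + size q + size v by rewrite /w !size_cat addnA.
(* This is the only case in which [w] is increasing. *)
have [/andP[/eqP q1 /nilP v0]|not_inc] := boolP ((size q == 1) && nilp v).
  rewrite /srw_size szw v0 addn0 /w v0 cats0.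
  case: q q1 increasing_pq => // x [|//] _ /path_sorted.
  by rewrite /rev /= => ->.
(* The descent at t = [size p + 1] lies inside [q] if [q] has two letters; otherwise it leads into
   [v], which by [wave_split] starts below [last 0 p]. *)
have desc : (size p).+1 < size w /\ letter w (size p).+2 < letter w (size p).+1.
  have [q1|q1] := ltnP 1 (size q); first by split; [lia | apply: letter_q; lia].
  case/and3P: wave_pqv => _ _; rewrite ltnNge q1 /=.
  have q1' : size q = 1 by lia.
  move: not_inc letter_last_q letter_head_v; rewrite q1' addn1 => /= vn0 -> ->.
  have vn0' : v != [::] by rewrite -size_eq0.
  rewrite (negPf vn0') /= => lt_vp; split.
    by move: vn0; rewrite /nilp; lia.
  exact: ltn_trans lt_vp last_p_lt_last_q.
have [szt dt] := desc.
have first_t : first_descent w = (size p).+1.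
  rewrite /first_descent /descents.
  have -> : (size w).-1 = size p + (1 + ((size w).-1 - (size p).+1)) by lia.
  rewrite iotaD filter_cat (@eq_in_filter _ _ pred0) ?filter_pred0 /=; last first.
    move=> j; rewrite mem_iota => /andP[_ ltj] /=.
    by apply/negbTE; rewrite -leqNgt ltnW // letter_p //; lia.
  by rewrite add1n dt.
have -> : srw_size w =
    last 0 [seq s <- iota (size p).+1 (size w - (size p).+1).+1
           | srw_index w (size p).+1 s].
  rewrite /srw_size first_t ifN //; apply/negP => /(sortedP 0)/(_ (size p) szt).
  by rewrite -[nth 0 w _]/(letter w (size p).+1)
     -[nth 0 w _.+1]/(letter w (size p).+2) /=; lia.
apply: last_filter_iota_leq => [|s]; first lia.
move=> /andP[le_ts les]; rewrite /srw_index /= letter_last_p.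
have all_q s' : s' <= size p + size q ->
    all (fun j => letter w j.+1 < letter w j) (iota (size p).+1 (s' - (size p).+1)).
  move=> les'; apply/allP => j; rewrite mem_iota => jr; apply: letter_q; lia.
have [le_s|lt_s] := leqP s (size p + size q).
  rewrite all_q //=; apply: leq_trans last_p_lt_last_q _; rewrite -letter_last_q.
  suff mono n : s <= n <= size p + size q -> letter w n <= letter w s.
    by apply: mono; lia.
  elim: n => [|n IHn] /andP[le_sn le_n]; first lia.
  have [<- //|ne_sn] := eqVneq s n.+1.
  apply: leq_trans (IHn _); last lia.
  by apply/ltnW/letter_q; lia.
apply/negbTE/negP => /andP[/allP dec lt_ps].
(* An admissible s beyond [q] forces a descent from [q] into [v], hence v_1 < w_{t-1} by
   [wave_split]; descending further to w_s cannot return above w_{t-1}. *)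
have v_n0 : v != [::] by apply/negP => /eqP v0; move: szw; rewrite v0 /=; lia.
have dec_v : head 0 v < last 0 q.
  by rewrite -letter_head_v -letter_last_q; apply: dec; rewrite mem_iota; lia.
case/and3P: wave_pqv => _ _.
rewrite (negPf v_n0) /= [last 0 q < _]ltnNge (ltnW dec_v) andbF /=.
move=> lt_vp; suff : letter w s <= head 0 v by lia.
rewrite -letter_head_v.
have -> : s = (size p + size q).+1 + (s - (size p + size q).+1) by lia.
have: (size p + size q).+1 + (s - (size p + size q).+1) <= s by lia.
elim: (s - _) => [|n IHn] le_n; first by rewrite addn0.
apply: leq_trans (IHn _); last lia.
rewrite addnS; apply/ltnW/dec; rewrite mem_iota; lia.
Qed.

Lemma wave_split_srw : srw w = p ++ q.
Proof. by rewrite /srw wave_split_size -size_cat /w catA take_size_cat. Qed.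

Lemma wave_split_rest : drop (srw_size w) w = v.
Proof. by rewrite wave_split_size -size_cat /w catA drop_size_cat. Qed.

Lemma wave_split_des : des (p ++ q) = (size q).-1.
Proof.
case/andP: decreasing_q => ltpq sq.
case: p increasing_pq ltpq => [|x p'] /=; first by rewrite des_decreasing.
rewrite cat_path => /and3P[_ pp _] ltpq; rewrite des_cat des_increasing // des_decreasing //.
case: q ltpq => //= y q' /andP[ltxy _].
by rewrite ltnNge ltnW // addn0.
Qed.

(** A descent from [q] into [v] rules out the second alternative of [wave_split], so it goes below
    [last 0 p]; the converse holds as [last 0 p < last 0 q]. *)
Lemma wave_split_srdes :
  srdes w = (size q).-1 + ((v != [::]) && (head 0 v < last 0 p)).
Proof.
rewrite /srdes wave_split_srw wave_split_des wave_split_size letter_head_v letter_last_q.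
congr (_ + nat_of_bool _).
rewrite /w !size_cat addnA -{1}[_ + size q]addn0 ltn_add2l lt0n size_eq0.
case: eqP => //= /eqP v0; case/and3P: wave_pqv => _ _; rewrite (negPf v0) /=.
move: last_p_lt_last_q; lia.
Qed.

Lemma wave_split_srdes_lt : srdes w < size (p ++ q).
Proof.
rewrite wave_split_srdes size_cat.
(* For empty [p], [last 0 p] is [0] and the extra descent cannot occur. *)
case: p q_gt0 => [|x p'] /=; first by rewrite ltn0 andbF; lia.
by move=> q0; case: (_ && _); lia.
Qed.

Lemma wave_split_srdes_eq0 : srdes w = 0 -> v = [::].
Proof.
rewrite wave_split_srdes; case/and3P: wave_pqv => _ _.
by case: (v =P [::]) => //= _ /orP[/andP[q1 _]|->]; lia.
Qed.

Lemma wave_split_sort : sort leq (p ++ q) = p ++ rev q.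
Proof.
apply: sort_increasing; last exact: path_sorted increasing_pq.
by rewrite perm_cat2l perm_sym perm_rev.
Qed.

(** [srdes] already counts the descent at the junction of the wave and [v]. *)
Lemma wave_split_des_cat : des w = des v + srdes w.
Proof.
rewrite /srdes wave_split_srw wave_split_size letter_head_v letter_last_q.
have -> : (size p + size q < size w) = (v != [::]).
  by rewrite /w !size_cat addnA -{1}[_ + size q]addn0 ltn_add2l lt0n size_eq0.
have -> : last 0 q = last 0 (p ++ q) by rewrite last_cat; case: q q_gt0.
rewrite /w catA; case: (p ++ q) (size_cat p q) => [|x u _].
  by move: q_gt0 => /=; lia.
by rewrite des_cat addnCA addnA.
Qed.

End WaveSplit.

(* The letter following the wave decides which of the two candidate waves with
   given content and given [srdes] occurs. *)
Lemma wave_split_inj p1 q1 p2 q2 v :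
  wave_split p1 q1 v -> wave_split p2 q2 v -> p1 ++ rev q1 = p2 ++ rev q2 ->
  srdes (p1 ++ q1 ++ v) = srdes (p2 ++ q2 ++ v) -> p1 = p2 /\ q1 = q2.
Proof.
wlog le_q : p1 q1 p2 q2 / size q1 <= size q2.
  move=> IH s1 s2 eqc eqd; case/orP: (leq_total (size q1) (size q2)) => le_q.
    exact: IH.
  by have [] := IH _ _ _ _ le_q s2 s1 (esym eqc) (esym eqd).
move=> s1 s2 eqc; rewrite !wave_split_srdes // => eqd.
have szc : size p1 + size q1 = size p2 + size q2.
  by have := congr1 size eqc; rewrite !size_cat !size_rev.
have [eq_q|ne_q] := eqVneq (size q1) (size q2).
  have sz_p : size p1 = size p2 by lia.
  move/eqP: eqc; rewrite eqseq_cat //.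
  by case/andP=> /eqP-> /eqP/(can_inj revK).
have q1_gt0 : 0 < size q1 by case/and3P: s1; case: (q1).
(* Each [srdes] is [(size q).-1] plus at most one, so unequal lengths differ by exactly one. *)
have sz_q2 : size q2 = (size q1).+1 by move: eqd; do 2!case: (_ && _) => /=; lia.
have sz_p1 : size p1 = (size p2).+1 by lia.
have last_pq : last 0 p1 = last 0 q2.
  have := congr1 (fun c => nth 0 c (size p2)) eqc.
  rewrite !nth_cat sz_p1 leqnn ltnn subnn nth_rev ?sz_q2 // subSS subn0.
  by rewrite -[size p2]/((size p2).+1.-1) -sz_p1 nth_last
     -[size q1]/((size q1).+1.-1) -sz_q2 nth_last.
(* Equal [srdes] forces v_1 < [last 0 p1] = [last 0 q2] but not v_1 < [last 0 p2], so no alternative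
   of [wave_split] is left for the second wave. *)
case/and3P: s2 => _ _; move: eqd; rewrite last_pq sz_q2.
by case: (v == [::]) => /=; case: (head 0 v < last 0 p2) => /=; lia.
Qed.

(** * One step of the recursion *)

Lemma hook_factorization_lec (w : W) f :
  hook_factorization w f -> lec w = \sum_(a <- f.2) word_inv a.
Proof.
move=> hf; rewrite /lec; congr (\sum_(a <- _.2) _).
exact: hook_factorization_unique (xchooseP (hook_factorization_exists w)) hf.
Qed.

(** Makes c_{d+1} an actual letter, so that [delta] never reads a default value. *)
Lemma srdes_lt_size (w : W) : w <> W_empty -> srdes w < size (srw w).
Proof.
move=> /wave_split_exists[p [q [v [-> pqv]]]].
by rewrite wave_split_srw // wave_split_srdes_lt.
Qed.

Lemma srw_cat_rest (w : W) : wval w = srw w ++ srw_rest w.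
Proof. by rewrite cat_take_drop. Qed.

Lemma srw_uniq (w : W) : uniq (srw w).
Proof. exact/take_uniq/W_uniq. Qed.

Lemma srdes_eq0_rest (w : W) : w <> W_empty -> srdes w = 0 -> srw_rest w = W_empty.
Proof.
move=> /wave_split_exists[p [q [v [def_w pqv]]]] d0; apply: val_inj => /=.
by rewrite def_w wave_split_rest //; apply: wave_split_srdes_eq0 pqv _; rewrite -def_w.
Qed.

Lemma des_srdes (w : W) : w <> W_empty -> des w = des (srw_rest w) + srdes w.
Proof.
move=> /wave_split_exists[p [q [v [def_w pqv]]]] /=.
by rewrite def_w wave_split_rest // wave_split_des_cat.
Qed.

Lemma size_rest_lt (w : W) : w <> W_empty -> size (srw_rest w) < size w.
Proof.
move=> w0; have := srdes_lt_size w0.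
by rewrite [in X in _ -> _ < X]srw_cat_rest size_cat; lia.
Qed.

Lemma W_rest_ind (P : W -> Prop) : P W_empty ->
  (forall w, w <> W_empty -> P (srw_rest w) -> P w) -> forall w, P w.
Proof.
move=> P0 PS w; have [n] := ubnP (size w); elim: n w => // n IHn w le_n.
case: (w =P W_empty) => [-> //|w0]; apply: PS => //; apply: IHn.
by have := size_rest_lt w0; lia.
Qed.

(** * Existence of theta *)

Lemma insubd_perm_W (s : seq nat) (w : W) :
  perm_eq s w -> wval (insubd W_empty s) = s.
Proof.
move=> sw; rewrite -[wval _]/(val _) insubdK //.
by rewrite unfold_in (perm_uniq sw) W_uniq (perm_all _ sw) W_gt0.
Qed.

Lemma delta_perm_W (w u : W) : w <> W_empty -> perm_eq u (srw_rest w) ->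
  perm_eq (u ++ delta (srdes w) (srw w)) w.
Proof.
move=> w0 pu; rewrite perm_catC [X in perm_eq _ X]srw_cat_rest.
by apply: perm_cat => //; apply/perm_delta/srdes_lt_size.
Qed.

(** The recursion is not structural, so [n] bounds its depth. Once [n] is at least [size w], the
    word built is a rearrangement of [w] and [insubd] never falls back to its default. *)
Fixpoint theta_fuel (n : nat) (w : W) : W :=
  if n is n'.+1 then
    if w == W_empty then W_empty
    else insubd W_empty (theta_fuel n' (srw_rest w) ++ delta (srdes w) (srw w))
  else W_empty.

Lemma theta_fuel_perm n (w : W) : size w <= n -> perm_eq (theta_fuel n w) w.
Proof.
elim: n w => [|n IHn] w le_n /=; first by case: w le_n => [[]].
case: eqP => [-> //|w0].
have pw : perm_eq (theta_fuel n (srw_rest w) ++ delta (srdes w) (srw w)) w.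
  by apply: delta_perm_W => //; apply: IHn; have := size_rest_lt w0; lia.
by rewrite (insubd_perm_W pw).
Qed.

Lemma theta_fuel_rec n (w : W) : size w <= n.+1 -> w <> W_empty ->
  wval (theta_fuel n.+1 w) = theta_fuel n (srw_rest w) ++ delta (srdes w) (srw w).
Proof.
move=> le_n w0 /=; rewrite (introF eqP w0).
have pw : perm_eq (theta_fuel n (srw_rest w) ++ delta (srdes w) (srw w)) w.
  by apply: delta_perm_W => //; apply: theta_fuel_perm; have := size_rest_lt w0; lia.
by rewrite (insubd_perm_W pw).
Qed.

(** Unfolding at fuel [size w] leaves [(size w).-1] for the rest, which may exceed the length of the
    rest. *)
Lemma theta_fuel_irrelevance n m (w : W) :
  size w <= n -> size w <= m -> theta_fuel n w = theta_fuel m w.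
Proof.
elim: n m w => [|n IHn] [|m] w le_n le_m //.
- by case: w le_n {le_m} => [[]].
- by case: w le_m {le_n} => [[]].
case: (w =P W_empty) => [-> //|w0]; apply: val_inj => /=.
have := size_rest_lt w0 => lt_r.
by rewrite (introF eqP w0) (IHn m) //; lia.
Qed.

Lemma theta_exists : exists theta, theta_rec theta.
Proof.
exists (fun w : W => theta_fuel (size w) w); split=> // w w0.
have lt_r := size_rest_lt w0.
have -> : size w = (size w).-1.+1 by lia.
rewrite theta_fuel_rec //; last lia.
by rewrite (@theta_fuel_irrelevance _ (size (srw_rest w))) //; lia.
Qed.

(** * Properties of theta *)

Section Theta.

Variable theta : W -> W.
Hypothesis theta_recP : theta_rec theta.

Lemma theta_unique theta' : theta_rec theta' -> theta' =1 theta.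
Proof.
move=> [theta'0 theta'S]; have [theta0 thetaS] := theta_recP.
elim/W_rest_ind => [|w w0 IHw]; first by rewrite theta0.
by apply: val_inj; rewrite /= theta'S // thetaS // IHw.
Qed.

Lemma theta_perm w : perm_eq (theta w) w.
Proof.
have [theta0 thetaS] := theta_recP.
elim/W_rest_ind: w => [|w w0 IHw]; first by rewrite theta0.
by rewrite thetaS // delta_perm_W.
Qed.

(** If [srdes w] is 0, the rest is empty and the increasing new block is gamma; otherwise the new
    block is a hook. *)
Lemma theta_hook_factorization w f : w <> W_empty ->
  hook_factorization (theta (srw_rest w)) f ->
  hook_factorization (theta w)
    (if srdes w == 0 then (delta (srdes w) (srw w), [::])
     else (f.1, rcons f.2 (delta (srdes w) (srw w)))).
Proof.
have [theta0 thetaS] := theta_recP.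
move=> w0 /and3P[/eqP def_r sf hf]; have lt_d := srdes_lt_size w0.
case: eqP => [d0|/eqP d_gt0]; apply/and3P; split=> //.
- by rewrite thetaS // srdes_eq0_rest // theta0 cats0.
- by rewrite d0; apply: delta0_increasing; rewrite ?srw_uniq -?d0.
- by rewrite thetaS // flatten_rcons catA -def_r.
by rewrite all_rcons hf hook_delta ?srw_uniq ?lt0n ?d_gt0.
Qed.

Lemma des_theta (w : W) : des w = lec (theta w).
Proof.
have [theta0 thetaS] := theta_recP.
elim/W_rest_ind: w => [|w w0 IHw].
  by rewrite theta0 (@hook_factorization_lec _ ([::], [::])) // big_nil.
have [f hf] := hook_factorization_exists (theta (srw_rest w)).
rewrite (hook_factorization_lec (theta_hook_factorization w0 hf)) des_srdes //.
case: eqP => [d0|d0]; first by rewrite d0 srdes_eq0_rest // big_nil.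
rewrite -cats1 big_cat big_seq1 word_inv_delta ?srw_uniq ?srdes_lt_size //=.
by rewrite IHw (hook_factorization_lec hf).
Qed.

Lemma theta_inj : injective theta.
Proof.
have [theta0 thetaS] := theta_recP.
elim/W_rest_ind => [|w1 w10 IHw] w2 eq12.
  apply/esym/val_inj/nilP; rewrite /nilp /= -(perm_size (theta_perm w2)) -eq12.
  by rewrite theta0.
have w20 : w2 <> W_empty.
  move=> w20; apply: w10; apply/val_inj/nilP.
  by rewrite /nilp /= -(perm_size (theta_perm w1)) eq12 w20 theta0.
have [f1 hf1] := hook_factorization_exists (theta (srw_rest w1)).
have [f2 hf2] := hook_factorization_exists (theta (srw_rest w2)).
have := theta_hook_factorization w10 hf1; rewrite eq12 => /hook_factorization_unique.
move/(_ _ (theta_hook_factorization w20 hf2)) => eqf.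
have [eq_rest eq_delta] : srw_rest w1 = srw_rest w2 /\
    delta (srdes w1) (srw w1) = delta (srdes w2) (srw w2).
  (* If both [srdes] vanish, both rests are empty. The mixed cases would equate an empty list of
     hooks with one ending in a hook. *)
  move: eqf; case: eqP => [d1|_]; case: eqP => [d2|_].
  - by move=> /(congr1 fst) eq_delta; rewrite !srdes_eq0_rest.
  - by case=> _; case: (f2.2).
  - by case=> _; case: (f1.2).
  case=> eqf1 /rcons_inj eqf2; split; last by move: eqf2 => /(congr1 snd).
  move: eqf2 => /(congr1 fst) /= eqf2; apply/IHw/val_inj => /=.
  by case/and3P: hf1 => /eqP-> _ _; case/and3P: hf2 => /eqP-> _ _; rewrite eqf1 eqf2.
have [eq_sort eq_d] :=
  delta_inj_index (srw_uniq w1) (srdes_lt_size w10) (srdes_lt_size w20) eq_delta.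
have [p1 [q1 [v1 [def1 s1]]]] := wave_split_exists w10.
have [p2 [q2 [v2 [def2 s2]]]] := wave_split_exists w20.
have eqv : v1 = v2.
  by have /= := congr1 wval eq_rest; rewrite def1 def2 !wave_split_rest.
rewrite -{v2}eqv in def2 s2.
apply: val_inj; move: eq_sort eq_d; rewrite /= def1 def2.
rewrite !wave_split_srw // (wave_split_sort s1) (wave_split_sort s2) => eq_sort eq_d.
by have [-> ->] := wave_split_inj s1 s2 eq_sort eq_d.
Qed.

(* [theta] permutes the finite set of rearrangements of a word. *)
Lemma theta_surj u : exists w, theta w == u.
Proof.
pose P := [seq insubd W_empty s | s <- permutations (wval u)].
have memP w : (w \in P) = perm_eq w u.
  apply/mapP/idP => [[s]|pw].
    by rewrite mem_permutations => su ->; rewrite (insubd_perm_W su).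
  by exists (wval w); rewrite ?mem_permutations //; apply: val_inj;
    rewrite /= (insubd_perm_W pw).
have UP : uniq P.
  rewrite map_inj_in_uniq ?permutations_uniq // => s1 s2.
  by rewrite !mem_permutations => p1 p2 /(congr1 wval);
    rewrite (insubd_perm_W p1) (insubd_perm_W p2).
(* An injective image of [P] inside [P] is all of [P]. *)
have [|||_ eq_mapP] := @uniq_min_size _ (map theta P) P.
- by rewrite map_inj_uniq //; apply: theta_inj.
- move=> _ /mapP[w wP ->]; move: wP; rewrite !memP; apply: perm_trans.
  exact: theta_perm.
- by rewrite (size_map theta) leqnn.
have : u \in map theta P by rewrite eq_mapP memP.
by case/mapP=> w _ ->; exists w.
Qed.

Lemma theta_bij : bijective theta.
Proof.
exists (fun u => xchoose (theta_surj u)) => w; last exact/eqP/(xchooseP (theta_surj w)).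
exact/theta_inj/eqP/(xchooseP (theta_surj (theta w))).
Qed.

End Theta.

(** * Permutations in one-line notation *)

Lemma oneline_inj n : injective (@oneline n).
Proof.
move=> s1 s2 /(congr1 wval) /= /eq_in_map eq12; apply/permP => i.
by have [] := eq12 i (mem_enum _ i) => /val_inj.
Qed.

Lemma oneline_perm n (sigma : 'S_n) : perm_eq (oneline sigma) (iota 1 n).
Proof.
rewrite /= -[iota 1 n]/(iota (1 + 0) n) iotaDl -val_enum_ord -map_comp.
rewrite (map_comp (fun i : 'I_n => i.+1) sigma) (perm_map (fun i : 'I_n => i.+1)) //.
apply: uniq_perm => [||i]; last 1 first.
- rewrite mem_enum; apply/mapP; exists (sigma^-1%g i); rewrite ?mem_enum //.
  by rewrite permKV.
- by rewrite map_inj_uniq ?enum_uniq //; apply: perm_inj.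
- exact: enum_uniq.
Qed.

Lemma oneline_onto n (w : W) : perm_eq w (iota 1 n) ->
  exists sigma : 'S_n, oneline sigma == w.
Proof.
move=> pw; have szw : size w = n by rewrite (perm_size pw) size_iota.
(* Elements of ['I_n] start at 0, hence the predecessor; it stays injective because letters are
   positive. *)
have lt_w (i : 'I_n) : (nth 0 w i).-1 < n.
  have : nth 0 w i \in wval w by rewrite mem_nth // szw.
  by rewrite (perm_mem pw) mem_iota; have := ltn_ord i; lia.
have f_inj : injective (fun i => Ordinal (lt_w i)).
  move=> i j /(congr1 val) /= eqij; apply/val_inj/eqP.
  rewrite -(nth_uniq 0 _ _ (W_uniq w)) ?szw ?ltn_ord //; apply/eqP.
  have gt0 (k : 'I_n) : 0 < nth 0 w k.
    by apply: (allP (W_gt0 w)); rewrite mem_nth // szw.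
  by rewrite -(prednK (gt0 i)) eqij prednK.
exists (perm f_inj); apply/eqP/val_inj => /=.
apply: (@eq_from_nth _ 0) => [|i]; rewrite size_map size_enum_ord ?szw // => lt_in.
rewrite (nth_map (Ordinal lt_in)) ?size_enum_ord // permE /= nth_enum_ord // prednK //.
by apply: (allP (W_gt0 w)); rewrite mem_nth // szw.
Qed.

Theorem theorem4p13 :
  (forall w : W, w <> W_empty -> srdes w < size (srw w)) /\
  exists theta : W -> W,
    [/\ theta_rec theta,
        forall theta' : W -> W, theta_rec theta' -> theta' =1 theta,
        bijective theta,
        forall w : W, des w = lec (theta w)
      & forall n : nat, exists2 theta_n : 'S_n -> 'S_n,
          bijective theta_n
          & forall sigma : 'S_n, theta (oneline sigma) = oneline (theta_n sigma)].
Proof.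
split; first exact: srdes_lt_size.
have [theta thetaP] := theta_exists; exists theta; split=> //.
- by move=> theta'; apply: theta_unique.
- exact: theta_bij.
- exact: des_theta.
move=> n.
(* As theta only rearranges letters, it keeps the rearrangements of 1, ..., n among themselves. *)
have ex_sigma (sigma : 'S_n) : exists tau : 'S_n, oneline tau == theta (oneline sigma).
  by apply: oneline_onto; rewrite (permPl (theta_perm thetaP _)) oneline_perm.
have theta_nP sigma := eqP (xchooseP (ex_sigma sigma)).
exists (fun sigma => xchoose (ex_sigma sigma)) => [|sigma]; last by rewrite theta_nP.
apply: injF_bij => s1 s2 /(congr1 (@oneline n)); rewrite !theta_nP.
by move/(theta_inj thetaP)/oneline_inj.
Qed.
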